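(* Let $S$ be a submonoid of $\mathbb{N}^2$. Then $S$ is gap absorbing if and only if $S$ is an ideal extension of $\mathbb{N}^2$.
   Context: $\mathbb{N}$ is the set of non-negative integers and $\mathbb{N}^2$ is the additive monoid with componentwise addition; $\mathbf{0}=(0,0)$. For $X,Y\subseteq\mathbb{N}^2$, $X+Y=\{x+y:x\in X,\ y\in Y\}$ and $2X=X+X$. For a submonoid $S$ of $\mathbb{N}^2$: $S^*=S\setminus\{\mathbf{0}\}$; $\mathcal{H}(S)=\mathbb{N}^2\setminus S$ is the set of gaps; $\mathcal{A}(S)=S^*\setminus(S^*+S^* )$ is the set of atoms. A subset $E\subseteq\mathbb{N}^2$ is an ideal if $E+\mathbb{N}^2\subseteq E$; $S$ is an ideal extension of $\mathbb{N}^2$ if $S=E\cup\{\mathbf{0}\}$ for some ideal $E$ of $\mathbb{N}^2$. $S$ is gap absorbing if $2\mathcal{H}(S)\subseteq\mathcal{H}(S)\cup\mathcal{A}(S)\cup 2\mathcal{A}(S)$ and $\mathcal{H}(S)+\mathcal{A}(S)\subseteq\mathcal{A}(S)\cup 2\mathcal{A}(S)$. *)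

(* Defs.v *)
From mathcomp Require Import all_boot all_algebra.
From mathcomp Require Import all_classical.

Set Implicit Arguments.
Unset Strict Implicit.
Unset Printing Implicit Defensive.

Import GRing.Theory.
Local Open Scope classical_set_scope.
Local Open Scope ring_scope.

(* [nat * nat] carries the library's product [nmodType] structure: addition is
   componentwise and [0] is [(0, 0)]. *)
Notation N2 := (nat * nat)%type.

Definition submonoid (S : set N2) : Prop := GRing.nmod_closed [in S].

Definition sumset (X Y : set N2) : set N2 := [set x + y | x in X & y in Y].

(* [2X] is the sumset [X + X], not the set of doubles of elements of [X]. *)
Definition twice (X : set N2) : set N2 := sumset X X.

Definition nonzero (S : set N2) : set N2 := S `\` [set 0].

Definition gaps (S : set N2) : set N2 := ~` S.

Definition atoms (S : set N2) : set N2 :=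
  nonzero S `\` sumset (nonzero S) (nonzero S).

(* The empty set counts as an ideal. *)
Definition ideal (E : set N2) : Prop := sumset E setT `<=` E.

Definition ideal_extension (S : set N2) : Prop :=
  exists E : set N2, ideal E /\ S = E `|` [set 0].

Definition gap_absorbing (S : set N2) : Prop :=
  twice (gaps S) `<=` gaps S `|` atoms S `|` twice (atoms S) /\
  sumset (gaps S) (atoms S) `<=` atoms S `|` twice (atoms S).

(* Main.v *)
Require Import Defs.
From mathcomp Require Import all_boot all_algebra.
From mathcomp Require Import all_classical.
From mathcomp Require Import zify.

(** If [S] is gap absorbing, write a nonzero element of [S] as an atom plus an
element of [S]: adding a gap to that atom stays in [S], so [S \ {0}] is an
ideal.

Conversely let [E = S \ {0}] be an ideal and let [s] in [E + E] be a sum of two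
gaps, or of a gap and an atom. Among the decompositions [s = x + y] in [E],
decrease [x.1 + y.2]: if [x = a + b] with [b.1 > 0], move [(b.1, 0)] from [x] to
[y], and symmetrically for [y]. This ends with two atoms unless [x] is a sum of
two elements of [E] on the vertical axis, or [y] one on the horizontal axis. For
[s] a sum of two gaps this cannot happen; for a gap plus an atom, one moves
[(0, 1)] from [x] to [y] until [x] is an atom, and then so is [y]. *)

(* Subsets of [N^2] are curried here, so that transposition is [flip] below. *)
Definition upclosed (E : nat -> nat -> Prop) : Prop :=
  forall i j k l, i <= k -> j <= l -> E i j -> E k l.

Definition splits (E : nat -> nat -> Prop) (s t : nat) : Prop :=
  exists a b c d, [/\ E a b, E c d, s = a + c & t = b + d].

Definition indec (E : nat -> nat -> Prop) (s t : nat) : Prop :=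
  E s t /\ ~ splits E s t.

(** The case where the descent gets stuck: one summand is [(0, a) + (0, b)], with no horizontal part
    to give away. For [flip E] with swapped arguments it describes the horizontal axis. *)
Definition vertical_split (E : nat -> nat -> Prop) (s t : nat) : Prop :=
  exists a b l, [/\ E 0 a, E 0 b, E s l & t = a + b + l].

Definition flip (E : nat -> nat -> Prop) (i j : nat) : Prop := E j i.

Lemma upclosed_flip {E} : upclosed E -> upclosed (flip E).
Proof. by move=> up i j k l ? ?; apply: up. Qed.

Lemma splits_flip E s t : splits (flip E) t s -> splits E s t.
Proof. by move=> [a [b [c [d [? ? -> ->]]]]]; exists b, a, d, c. Qed.

Lemma indec_flip E s t : indec (flip E) t s <-> indec E s t.
Proof.
split=> -[Es nsp]; split=> // sp; apply: nsp; last exact: splits_flip.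
exact: (@splits_flip (flip E)).
Qed.

Lemma splits_indec_flip E s t :
  splits (indec (flip E)) t s -> splits (indec E) s t.
Proof.
move=> [a [b [c [d [/indec_flip ? /indec_flip ? -> ->]]]]].
by exists b, a, d, c.
Qed.

Lemma splits_indec_or_axis {E s t} : upclosed E -> splits E s t ->
  [\/ splits (indec E) s t, vertical_split E s t
    | vertical_split (flip E) t s].
Proof.
move=> up [x1 [x2 [y1 [y2 [Ex Ey -> ->]]]]].
have [n] := ubnP (x1 + y2); elim: n => // n IHn in x1 x2 y1 y2 Ex Ey *.
move=> lt_n.
have [[a [b [c [d [Ea Ec def1 def2]]]]]|nx] := pselect (splits E x1 x2).
  have [x10|x1_gt0] := posnP x1.
    have [a0 c0] : a = 0 /\ c = 0 by lia.
    subst; constructor 2; exists b, d, y2.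
    by split=> //; apply: up Ey.
  (* Moving [(v, 0)] to the other summand lowers the measure [x1 + y2] by [v]. At each use,
     [(u, x2)] dominates [(a, b)] or [(c, d)], so it stays in [E]. *)
  have step u v : x1 = u + v -> 0 < v -> E u x2 ->
      [\/ splits (indec E) (x1 + y1) (x2 + y2),
          vertical_split E (x1 + y1) (x2 + y2)
        | vertical_split (flip E) (x2 + y2) (x1 + y1)].
    move=> def v_gt0 Eu; rewrite def -addnA; apply: IHn => //; last lia.
    by apply: up Ey; lia.
  have [c0|c_gt0] := posnP c.
    by apply: (step c a); [lia | lia | apply: up Ec; lia].
  by apply: (step a c) => //; apply: up Ea; lia.
have [[a [b [c [d [Ea Ec def1 def2]]]]]|ny] :=
    pselect (splits E y1 y2); last first.
  by constructor 1; exists x1, x2, y1, y2.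
have [y20|y2_gt0] := posnP y2.
  have [b0 d0] : b = 0 /\ d = 0 by lia.
  subst; constructor 3; exists a, c, x1.
  by split=> //; [apply: up Ex; lia | lia].
have step u v : y2 = u + v -> 0 < v -> E y1 u ->
    [\/ splits (indec E) (x1 + y1) (x2 + y2),
        vertical_split E (x1 + y1) (x2 + y2)
      | vertical_split (flip E) (x2 + y2) (x1 + y1)].
  move=> def v_gt0 Eu; rewrite def (addnC u) addnA; apply: IHn => //; last lia.
  by apply: up Ex; lia.
have [d0|d_gt0] := posnP d.
  by apply: (step d b); [lia | lia | apply: up Ec; lia].
by apply: (step b d) => //; apply: up Ea; lia.
Qed.

Lemma not_le_gap {E h1 h2 i j} : upclosed E -> ~ E h1 h2 -> E i j ->
  (h1 < i) || (h2 < j).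
Proof.
move=> up nEh Eij; apply: contra_notT nEh.
rewrite negb_or -!leqNgt => /andP[? ?]; exact: up Eij.
Qed.

(** Otherwise the remainder [(s - i, t - j)] would dominate [(k, l)], hence lie in [E], and [(s, t)]
    would split. *)
Lemma not_add_le_indec {E s t i j k l} : upclosed E -> indec E s t ->
  E i j -> E k l -> (s < i + k) || (t < j + l).
Proof.
move=> up [_ nsp] Ei Ek; apply: contra_notT nsp.
rewrite negb_or -!leqNgt => /andP[? ?].
exists i, j, (s - i), (t - j); split=> //; [apply: up Ek; lia | lia | lia].
Qed.

(** A gap dominates no point of [E], so [h2 < a] and [g2 < b], too small for the total height
    [a + b + l]. *)
Lemma gap_add_gap_not_vertical {E h1 h2 g1 g2} : upclosed E ->
  ~ E h1 h2 -> ~ E g1 g2 -> ~ vertical_split E (h1 + g1) (h2 + g2).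
Proof.
move=> up nEh nEg [a [b [l [Ea Eb _ def]]]].
have := not_le_gap up nEh Ea; have := not_le_gap up nEg Eb; lia.
Qed.

Lemma gap_add_gap {E h1 h2 g1 g2} : upclosed E -> ~ E h1 h2 -> ~ E g1 g2 ->
  splits E (h1 + g1) (h2 + g2) -> splits (indec E) (h1 + g1) (h2 + g2).
Proof.
move=> up nEh nEg sp; have upf := upclosed_flip up.
have [//|/(gap_add_gap_not_vertical up nEh nEg)//|] :=
  splits_indec_or_axis up sp.
by move/(gap_add_gap_not_vertical (E := flip E) upf nEh nEg).
Qed.

Lemma gap_add_indec_vertical {E h1 h2 s t} : upclosed E -> ~ E h1 h2 ->
  indec E s t -> vertical_split E (h1 + s) (h2 + t) ->
  splits (indec E) (h1 + s) (h2 + t).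
Proof.
move=> up nEh As [a [b [l [Ea Eb El def_t]]]].
have [n] := ubnP (a + b); elim: n => // n IHn in a b l Ea Eb El def_t *.
move=> lt_n.
have nEa := not_le_gap up nEh Ea; have nEb := not_le_gap up nEh Eb.
have nab := not_add_le_indec up As Ea Eb.
(* Since [h2 < b], [b] is positive, so lowering [(0, a + b)] by one still leaves a point above
   [(0, a)]. *)
have Ek : E 0 (a + b).-1 by apply: up Ea; lia.
have El' : E (h1 + s) l.+1 by apply: up El; lia.
have [[a' [b' [c' [d' [Ea' Ec' def1 def2]]]]]|nk] :=
    pselect (splits E 0 (a + b).-1).
  have [a0 c0] : a' = 0 /\ c' = 0 by lia.
  by subst; apply: (IHn b' d' l.+1) => //; lia.
exists 0, (a + b).-1, (h1 + s), l.+1; split=> //; last lia.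
(* From [t < a + b] follows [l.+1 <= h2], so [v], not being below the gap, has [h1 < v1]. From
   [h2 < b] follows [a + l.+1 <= t], so [(0, a) + u] not being below the atom gives [s < u1]. Then
   [u1 + v1] exceeds [h1 + s]. *)
split=> // -[u1 [u2 [v1 [v2 [Eu Ev def1 def2]]]]].
have := not_le_gap up nEh Eu; have := not_le_gap up nEh Ev.
have := not_add_le_indec up As Ea Eu; have := not_add_le_indec up As Ea Ev.
lia.
Qed.

Lemma gap_add_indec {E h1 h2 s t} : upclosed E -> ~ E h1 h2 ->
  indec E s t -> splits E (h1 + s) (h2 + t) ->
  splits (indec E) (h1 + s) (h2 + t).
Proof.
move=> up nEh As sp; have upf := upclosed_flip up.
have [//|/(gap_add_indec_vertical up nEh As)//|] :=
  splits_indec_or_axis up sp.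
have Asf := proj2 (indec_flip E s t) As.
move/(gap_add_indec_vertical (E := flip E) upf nEh Asf).
exact: splits_indec_flip.
Qed.

Local Open Scope classical_set_scope.

Definition curried (X : set N2) (i j : nat) : Prop := X (i, j).

Import GRing.Theory.

Lemma sumset_splits (X : set N2) (i j : nat) :
  sumset X X (i, j) <-> splits (curried X) i j.
Proof.
split=> [[[a b] Xa [[c d] Xc [<- <-]]]|[a [b [c [d [Xa Xc -> ->]]]]]].
  by exists a, b, c, d.
by exists (a, b) => //; exists (c, d).
Qed.

Lemma atoms_indec (S : set N2) :
  curried (atoms S) = indec (curried (nonzero S)).
Proof.
apply/funext => i; apply/funext => j; apply/propext.
by split=> -[Sij nsp]; split=> // /sumset_splits.
Qed.

Lemma twice_atoms_splits (S : set N2) (i j : nat) :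
  twice (atoms S) (i, j) <-> splits (indec (curried (nonzero S))) i j.
Proof. by rewrite -atoms_indec; exact: sumset_splits. Qed.

Lemma add_N2_eq0 (x y : N2) : (x + y)%R = 0%R -> x = 0%R /\ y = 0%R.
Proof.
move: x y => [a b] [c d] [? ?].
have [-> -> -> ->] : [/\ a = 0, b = 0, c = 0 & d = 0] by split; lia.
by [].
Qed.

(** Descent on the coordinate sum: if [x] is not an atom, it has a strictly smaller nonzero summand
    [u] in [S], and the other summand joins [y]. *)
Lemma exists_atom_summand {S : set N2} : submonoid S -> forall x : N2,
  nonzero S x -> exists a y, [/\ atoms S a, S y & x = (a + y)%R].
Proof.
move=> [S0 SD] x; have [n] := ubnP (x.1 + x.2); elim: n => // n IHn in x *.
move=> lt_n Sx.
have [[u Su [v Sv uv]]|nsp] :=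
    pselect (sumset (nonzero S) (nonzero S) x); last first.
  by exists x, 0%R; rewrite addr0; split=> //; move: S0; rewrite inE.
have [|a [y [Aa Sy def_u]]] := IHn u _ Su.
  move: Sv.2 lt_n; rewrite -uv; case: (u) (v) => [a b] [c d] /= nz.
  have : c + d != 0.
    by apply/eqP => cd0; apply: nz; congr pair; lia.
  by rewrite /=; lia.
exists a, (y + v)%R; rewrite -uv def_u addrA; split=> //.
have /= := SD y v; rewrite !inE; apply=> //.
exact: Sv.1.
Qed.

Theorem corollary8p4 (S : set N2) (hS : submonoid S) :
  gap_absorbing S <-> ideal_extension S.
Proof.
have [S0 SD] := hS.
have {}S0 : S 0%R by move: S0; rewrite inE.
have {}SD x y : S x -> S y -> S (x + y)%R.
  by move=> Sx Sy; have := SD x y; rewrite !inE; apply.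
split=> [[_ absorb]|[E [idE defS]]].
  exists (nonzero S); split; last first.
    apply/seteqP; split=> x; last by case=> [[]|->].
    by move=> Sx; have [->|nx] := pselect (x = 0%R); [right | left].
  move=> _ [x Sx [y _ <-]]; split; last by case/add_N2_eq0 => x0 _; case: Sx.
  have [Sy|nSy] := pselect (S y); first by apply: SD => //; case: Sx.
  have [a [z [Aa Sz ->]]] := exists_atom_summand hS x Sx.
  (* Here [y] is a gap: in [(a + y) + z], absorption puts [a + y] among the atoms or their pairwise
     sums, hence in [S]. *)
  rewrite addrAC; apply: (SD) => //.
  have Hya : sumset (gaps S) (atoms S) (a + y)%R.
    by exists y => //; exists a => //; rewrite addrC.
  case: (absorb _ Hya) => [[[]]//|[u [[Su _] _] [v [[Sv _] _] <-]]].
  exact: SD.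
pose F := curried (nonzero S).
have nzD x y : nonzero S x -> nonzero S (x + y)%R.
  move=> [Sx nx]; split; last by case/add_N2_eq0.
  by move: Sx; rewrite defS => -[Ex|//]; left; apply: idE;
    exists x => //; exists y.
have up : upclosed F.
  move=> i j k l le_ik le_jl /(nzD _ (k - i, l - j)).
  by rewrite /F /curried; congr (nonzero S (_, _)); apply: subnKC.
have gapF i j : gaps S (i, j) -> ~ F i j by move=> nS [].
(* Zero stands apart, being in [S] but not in [F]. *)
have trichotomy i j :
    [\/ gaps S (i, j), indec F i j | splits F i j] \/ (i, j) = 0%R.
  have [|nz] := pselect ((i, j) = 0%R :> N2); [by right | left].
  have [Sij|] := pselect (S (i, j)); last by constructor 1.
  by have [|nsp] := pselect (splits F i j); [constructor 3 | constructor 2].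
split.
  move=> _ [[h1 h2] Hh [[g1 g2] Hg <-]].
  have [[Hs|As|sp]|hg0] := trichotomy (h1 + g1) (h2 + g2).
  - by left; left.
  - by left; right; move: As; rewrite -atoms_indec.
  - by right; apply/twice_atoms_splits; apply: gap_add_gap => //; apply: gapF.
  - by have [h0 _] := add_N2_eq0 (h1, h2) (g1, g2) hg0; case: Hh; rewrite h0.
move=> _ [[h1 h2] Hh [[s t] As <-]].
have nzs : nonzero S (h1 + s, h2 + t).
  by have := nzD _ (h1, h2) As.1; rewrite addrC.
have iAs : indec F s t by rewrite -atoms_indec.
have [[Hs|Ahs|sp]|hs0] := trichotomy (h1 + s) (h2 + t).
- by case: Hs; case: nzs.
- by left; move: Ahs; rewrite -atoms_indec.
- by right; apply/twice_atoms_splits; apply: gap_add_indec => //; apply: gapF.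
- by case: nzs.
Qed.
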